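(* Let $LB$ be a lower bound on the optimal objective function value of the discrete $\alpha$-neighbor $p$-center problem. Then $\mathcal{L}_\alpha(LB)=LB$ holds if and only if there is a feasible solution with objective function value at most $p$ for the linear program $$\min \sum_{j\in N} y_j$$ subject to $$\sum_{j\in N\setminus\{i\}:\, d_{ij}\le LB} y_j\ge\alpha(1-y_i)\quad\forall i\in N,$$ $$\sum_{j\in N\setminus(N_\beta\cup\{i\}):\, d_{ij}\le LB} y_j\ge(\alpha-\beta)(1-y_i)\quad\forall i\in N,\ \forall\beta\in\{1,\dots,\alpha\},\ \forall N_\beta\subseteq N\setminus\{i\} \text{ with } |N_\beta|=\beta,$$ $$0\le y_j\le1\quad\forall j\in N.$$
   Context: Discrete $\alpha$-neighbor $p$-center problem (d-$\alpha$-$p$CP): given are a finite set of points $N$, a positive integer $p<|N|$, a positive integer $\alpha\le p$, and distances $d_{ij}\ge 0$ for $i,j\in N$. A feasible solution is a set $P\subseteq N$ with $|P|=p$ (open facilities). For $i\in N\setminus P$ let $d_\alpha(P,i)=\min_{A\subseteq P,|A|=\alpha}\max_{j\in A} d_{ij}$, and let $f_\alpha(P)=\max_{i\in N\setminus P} d_\alpha(P,i)$ be the objective function value of $P$. The problem is $\min_{P\subseteq N,|P|=p} f_\alpha(P)$. $\mathcal{L}_\alpha(LB)$ denotes the optimal objective function value of the linear program (APCLB) in real variables $y_j$ ($j\in N$), $x_{ij}$ ($i,j\in N$, $i\ne j$), $z$: minimize $z$ subject to - $\sum_{j\in N} y_j=p$; - $\sum_{j\in N\setminus\{i\}} x_{ij}=\alpha(1-y_i)$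 for all $i\in N$; - $x_{ij}\le y_j$ for all $i,j\in N$, $i\ne j$; - $y_i+x_{ij}\le1$ for all $i,j\in N$, $i\neq j$; - $LB\,y_i+\max\{LB,d_{ij}\}x_{ij}\le z$ for all $i,j\in N$, $i\ne j$; - $\alpha\,LB\,y_i+\sum_{j\in N\setminus\{i\}}\max\{LB,d_{ij}\}x_{ij}\le\alpha z$ for all $i\in N$; - $0\le x_{ij}$ for all $i,j\in N$, $i\ne j$; $0\le y_j\le 1$ for all $j\in N$; $z\ge LB$. *)

(* Defs.v *)
From HB Require Import structures.
From mathcomp Require Import all_boot all_order all_algebra.
From mathcomp Require Import boolp classical_sets reals.

Set Implicit Arguments.
Unset Strict Implicit.
Unset Printing Implicit Defensive.

Import Order.TTheory GRing.Theory Num.Theory.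
Local Open Scope ring_scope.

(** Minima over sets of reals are rendered by [inf].  Under the standing
    assumptions [0 < p < #|N|], [0 < alpha <= p], [0 <= d i j] and, for
    [d_alpha], [#|P| = p], every set
    below whose [inf] is taken is nonempty and bounded from below, and its
    infimum is attained: the sets are finite, except for the set of objective
    values of [APCLB], which is the projection of a nonempty polyhedron. *)

(** [d_alpha(P, i)].  The base value [0] of the maximum is harmless since
    distances are nonnegative; the same holds for [f_alpha]. *)
Definition d_alpha (R : realType) (N : finType) (d : N -> N -> R)
    (alpha : nat) (P : {set N}) (i : N) : R :=
  inf [set \big[Num.max/0]_(j in A) d i j
      | A in [set A : {set N} | A \subset P /\ #|A| = alpha]]%classic.

Definition f_alpha (R : realType) (N : finType) (d : N -> N -> R)
    (alpha : nat) (P : {set N}) : R :=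
  \big[Num.max/0]_(i in ~: P) d_alpha d alpha P i.

(** Optimal value of the discrete alpha-neighbor p-center problem. *)
Definition center_opt (R : realType) (N : finType) (d : N -> N -> R)
    (p alpha : nat) : R :=
  inf [set f_alpha d alpha P | P in [set P : {set N} | #|P| = p]]%classic.

(** The variables [x i j] exist only for [i != j]: the diagonal entries of [x]
    occur in no constraint. *)
Record APCLB_feasible (R : realType) (N : finType) (d : N -> N -> R)
    (p alpha : nat) (LB : R) (y : N -> R) (x : N -> N -> R) (z : R) : Prop := {
  APCLB_card : \sum_j y j = p%:R;
  APCLB_assign : forall i, \sum_(j | j != i) x i j = alpha%:R * (1 - y i);
  APCLB_open : forall i j, i != j -> x i j <= y j;
  APCLB_self : forall i j, i != j -> y i + x i j <= 1;
  APCLB_dist : forall i j, i != j ->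
    LB * y i + Num.max LB (d i j) * x i j <= z;
  APCLB_sumdist : forall i,
    alpha%:R * LB * y i + \sum_(j | j != i) Num.max LB (d i j) * x i j
      <= alpha%:R * z;
  APCLB_x_ge0 : forall i j, i != j -> 0 <= x i j;
  APCLB_y_bounds : forall j, 0 <= y j <= 1;
  APCLB_z_ge : LB <= z }.

(** [L_alpha(LB)], the optimal value of [APCLB]. *)
Definition L_alpha (R : realType) (N : finType) (d : N -> N -> R)
    (p alpha : nat) (LB : R) : R :=
  inf [set z : R | exists y x, APCLB_feasible d p alpha LB y x z]%classic.

(** Feasibility for the fractional covering program in [y] alone, with
    objective [\sum_j y j]. *)
Record cover_feasible (R : realType) (N : finType) (d : N -> N -> R)
    (alpha : nat) (LB : R) (y : N -> R) : Prop := {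
  cover_all : forall i,
    \sum_(j | (j != i) && (d i j <= LB)) y j >= alpha%:R * (1 - y i);
  cover_sub : forall (i : N) (beta : nat) (Nb : {set N}),
    (1 <= beta <= alpha)%N -> Nb \subset [set~ i] -> #|Nb| = beta ->
    \sum_(j | (j \notin i |: Nb) && (d i j <= LB)) y j
      >= (alpha%:R - beta%:R) * (1 - y i);
  cover_y_bounds : forall j, 0 <= y j <= 1 }.

(* Main.v *)
Require Import Defs.
From HB Require Import structures.
From mathcomp Require Import all_boot all_order all_algebra ring lra.
From mathcomp Require Import boolp classical_sets reals.
From mathcomp Require Import topology normedtype sequences.
Import numFieldTopology.Exports numFieldNormedType.Exports.

Set Implicit Arguments.
Unset Strict Implicit.
Unset Printing Implicit Defensive.

Import Order.TTheory GRing.Theory Num.Theory.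
Local Open Scope ring_scope.

(** Since every feasible [z] of APCLB is at least [LB], the equality
    [L_alpha = LB] should mean that APCLB has a feasible point with [z = LB].
    This needs the infimum to be attained ([APCLB_attained], a compactness
    argument) and APCLB to be feasible ([APCLB_nonempty], which excludes the
    conventional infimum [0] of the empty set).

    At a feasible point with [z = LB], the aggregated distance constraint reads
    [\sum_j (max LB (d i j) - LB) * x i j <= 0], so [x] lives on the edges of
    length at most [LB] ([APCLB_tight_support]).  Conversely, an [x] that lives
    on these edges satisfies both distance constraints with [z = LB], provided
    that [0 <= LB].  What remains is a question about each client [i]
    separately: can the demand [alpha * (1 - y i)] be split over the [j] near
    [i] with shares [0 <= x i j <= min (y j) (1 - y i)]?  It can exactly when
    the sum of these capacities is at least the demand.  That sum of minima is
    the least of the values [\sum_(j notin T) y j + #|T| * (1 - y i)], [j] near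
    [i], over all sets [T] of near points, so the single inequality amounts to
    the family of inequalities indexed by sets in the covering program
    ([APCLB_tight_cover], [cover_min_ge]).

    Two adjustments relate the programs.  A cover of total mass at most [p] is
    moved towards the all-ones vector until its mass is [p] ([cover_pad]).  A
    negative [LB] admits no near points at all, hence forces the cover to be
    all ones, of mass [#|N| > p] ([cover_LB_ge0]). *)

(** * The linear program APCLB attains its optimal value *)

(** Along an ultrafilter, bounded sequences converge without passing to
    subsequences; all coordinates of a sequence of points of the program then
    have limits simultaneously. *)
Lemma ultrafilter_cvg01 (R : realType) (U : set_system nat) (u : nat -> R) :
  UltraFilter U -> (forall n, 0 <= u n <= 1) -> cvg (u n @[n --> U])%classic.
Proof.
move=> ultraU u01; have := @segment_compact R 0 1; rewrite compact_ultra.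
have ultra_u : UltraFilter (u n @[n --> U])%classic.
  split=> [|G properG sub]; first exact: fmap_proper_filter.
  rewrite predeqE => A; split; last exact: sub.
  move=> GA; case: (in_ultra_setVsetC (u @^-1` A)%classic ultraU) => // UnA.
  suff /filter_ex[? []] : G (A `&` ~` A)%classic by [].
  by apply: filterI => //; apply: sub.
move=> compact01; have [|l [_ ul]] := compact01 _ ultra_u.
  by apply: (@filterE _ U) => n; rewrite /= in_itv /=.
by apply/cvg_ex; exists l.
Qed.

(** The uniform point [y = p / n], [x = alpha * (1 - p / n) / (n - 1)] with
    [n = #|N|] is feasible once [z] dominates all coefficients; the inequality
    [x <= y] uses [alpha <= p], and [x + y <= 1] uses [alpha <= n - 1]. *)
Lemma APCLB_nonempty (R : realType) (N : finType) (d : N -> N -> R)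
    (p alpha : nat) (LB : R) :
  (0 < p < #|N|)%N -> (0 < alpha <= p)%N ->
  exists z y x, APCLB_feasible d p alpha LB y x z.
Proof.
case/andP=> p_gt0 p_lt /andP[a_gt0 a_le].
have sum_const (i : N) (c : R) : \sum_(j | j != i) c = (#|N|%:R - 1) * c.
  rewrite sumr_const cardC1 -[LHS]mulr_natl.
  by case: #|N| p_lt => // m _; rewrite -[m.+1%:R]natr1 addrK.
set n : R := #|N|%:R; set q : R := p%:R; set a : R := alpha%:R.
have q_ge1 : 1 <= q by rewrite ler1n.
have a_ge1 : 1 <= a by rewrite ler1n.
have a_leq : a <= q by rewrite ler_nat.
have q_len : q + 1 <= n by rewrite natr1 ler_nat.
set c := q / n; set b := a * (1 - c) / (n - 1).
have c0 : 0 <= c by rewrite divr_ge0 //; lra.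
have c1 : c <= 1 by rewrite ler_pdivrMr; lra.
have b0 : 0 <= b by rewrite divr_ge0 ?mulr_ge0 //; lra.
have nc : n * c = q by rewrite mulrC divfK // gt_eqF //; lra.
have nb : (n - 1) * b = a * (1 - c) by rewrite mulrC divfK // gt_eqF //; lra.
have bc : b <= c.
  rewrite -(ler_pM2l (_ : 0 < n - 1)) ?nb; last by lra.
  have : 0 <= (q - a) * (1 - c) by apply: mulr_ge0; lra.
  have : 0 <= (q - 1) * c by apply: mulr_ge0; lra.
  nra.
have cb : c + b <= 1.
  suff : b <= 1 - c by lra.
  rewrite -(ler_pM2l (_ : 0 < n - 1)) ?nb; last by lra.
  by apply: ler_wpM2r; lra.
pose m i j : R := Num.max LB (d i j).
(* the sum is a crude common bound, valid for single terms and for rows *)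
pose M := `|LB| + \sum_i \sum_j `|m i j|.
have row_le i : \sum_(j | j != i) `|m i j| <= \sum_i \sum_j `|m i j|.
  rewrite [leRHS](bigD1 i) //= -[leLHS]addr0 lerD //; last first.
    by apply: sumr_ge0 => k _; apply: sumr_ge0.
  rewrite [leRHS](bigID (fun j => j != i)) /= lerDl.
  exact: sumr_ge0.
have m_le i j : i != j -> `|m i j| <= \sum_i \sum_j `|m i j|.
  move=> ij; apply: le_trans (row_le i); rewrite (bigD1 j) 1?eq_sym //= lerDl.
  exact: sumr_ge0.
have scale_le (t u : R) : 0 <= u <= 1 -> t * u <= `|t|.
  move=> /andP[u0 u1]; apply: le_trans (ler_norm _) _.
  by rewrite normrM (ger0_norm u0) ler_piMr.
have c01 : 0 <= c <= 1 by apply/andP.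
have b01 : 0 <= b <= 1 by apply/andP; split; lra.
exists M, (fun=> c), (fun _ _ => b); split => //.
- by rewrite sumr_const -[LHS]mulr_natl nc.
- by move=> i; rewrite sum_const nb.
- move=> i j ij.
  exact: lerD (scale_le _ _ _) (le_trans (scale_le _ _ _) (m_le i j ij)).
- move=> i; rewrite /M mulrDr lerD //.
    by rewrite -mulrA ler_wpM2l ?scale_le //; lra.
  apply: (@le_trans _ _ (\sum_i \sum_j `|m i j|)); last first.
    by rewrite ler_peMl //; apply: sumr_ge0 => k _; apply: sumr_ge0.
  apply: le_trans (row_le i); apply: ler_sum => j _; exact: scale_le.
- apply: le_trans (ler_norm _) _; rewrite lerDl.
  by apply: sumr_ge0 => k _; apply: sumr_ge0.
Qed.

(** All constraints are closed conditions in finitely many coordinates, and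
    [x] and [y] range over [[0, 1]] off the diagonal; a limit of almost optimal
    points is therefore feasible, with [z] equal to the infimum. *)
Lemma APCLB_attained (R : realType) (N : finType) (d : N -> N -> R)
    (p alpha : nat) (LB : R) :
  (exists z y x, APCLB_feasible d p alpha LB y x z) ->
  exists y x, APCLB_feasible d p alpha LB y x (L_alpha d p alpha LB).
Proof.
move=> ne; pose L := L_alpha d p alpha LB; rewrite -/L.
have hi : has_inf
    [set z : R | exists y x, APCLB_feasible d p alpha LB y x z]%classic.
  by split=> //; exists LB => z [y [x /APCLB_z_ge]].
have near_opt n : exists w : R * (N -> R) * (N -> N -> R),
    L <= w.1.1 < L + harmonic n /\
    APCLB_feasible d p alpha LB w.1.2 w.2 w.1.1.
  have h_gt0 : 0 < harmonic n :> R by rewrite /harmonic /= invr_gt0 ltr0n.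
  have [z [y [x F]] zlt] := inf_adherent h_gt0 hi.
  exists (z, y, x); split => //; rewrite zlt andbT.
  by apply: ge_inf hi.2 _ _; exists y, x.
have [w wP] := choice near_opt.
pose z n := (w n).1.1; pose y n := (w n).1.2; pose x n := (w n).2.
have F n : APCLB_feasible d p alpha LB (y n) (x n) (z n) by case: (wP n).
have [U [ultraU subU]] := ultraFilterLemma eventually_filter.
have zL : (z n @[n --> U] --> L)%classic.
  apply: (@cvg_trans _ (z n @[n --> \oo])%classic).
    by move=> A; apply: subU.
  apply: (@squeeze_cvgr _ _ _ _ (fun=> L) (fun n => L + harmonic n)).
  - by near=> n; case: (wP n) => /andP[? /ltW ?] _; apply/andP.
  - exact: cvg_cst.
  - rewrite -[X in (_ --> X)%classic]addr0.
    by apply: cvgD; [exact: cvg_cst | exact: cvg_harmonic].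
pose y0 j := lim (y n j @[n --> U])%classic.
pose x0 i j := lim (x n i j @[n --> U])%classic.
have yL j : (y n j @[n --> U] --> y0 j)%classic.
  by apply: ultrafilter_cvg01 => n; apply: APCLB_y_bounds (F n) j.
have xL i j : i != j -> (x n i j @[n --> U] --> x0 i j)%classic.
  move=> ij; apply: ultrafilter_cvg01 => n; rewrite (APCLB_x_ge0 (F n)) //=.
  apply: le_trans (APCLB_open (F n) ij) _.
  by case/andP: (APCLB_y_bounds (F n) j).
have le_U (f g : nat -> R) (a b : R) :
    (f n @[n --> U] --> a)%classic -> (g n @[n --> U] --> b)%classic ->
    (forall n, f n <= g n) -> a <= b.
  move=> fa gb fg; rewrite -subr_ge0.
  apply: (cvgr_to_ge (cvgB gb fa)); apply: filterE => n.
  by rewrite subr_ge0.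
have eq_U (f g : nat -> R) (a b : R) :
    (f n @[n --> U] --> a)%classic -> (g n @[n --> U] --> b)%classic ->
    (forall n, f n = g n) -> a = b.
  move=> fa gb fg; apply/le_anti/andP.
  by split; [apply: le_U fa gb _ | apply: le_U gb fa _] => n; rewrite fg.
have sum_U (P : pred N) (f : nat -> N -> R) (a : N -> R) :
    (forall j, P j -> f n j @[n --> U] --> a j)%classic ->
    (\sum_(j | P j) f n j @[n --> U] --> \sum_(j | P j) a j)%classic.
  by move=> fa; apply: cvg_big => //; exact: add_continuous.
have mul_U (c : R) (f : nat -> R) (a : R) :
    (f n @[n --> U] --> a)%classic -> (c * f n @[n --> U] --> c * a)%classic.
  exact: cvgMl_tmp.
have cst_U (c : R) : ((fun=> c) n @[n --> U] --> c)%classic by exact: cvg_cst.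
exists y0, x0; split.
- apply: eq_U (sum_U _ _ _ (fun j _ => yL j)) (cst_U _) _ => n.
  exact: APCLB_card (F n).
- move=> i; have xiL j : j != i -> (x n i j @[n --> U] --> x0 i j)%classic.
    by rewrite eq_sym; apply: xL.
  apply: eq_U (sum_U _ _ _ xiL)
    (mul_U alpha%:R _ _ (cvgB (cst_U 1) (yL i))) _ => n.
  exact: APCLB_assign (F n) i.
- move=> i j ij; apply: le_U (xL _ _ ij) (yL j) _ => n.
  by have := APCLB_open (F n) ij.
- move=> i j ij; apply: le_U (cvgD (yL i) (xL _ _ ij)) (cst_U 1) _ => n.
  by have := APCLB_self (F n) ij.
- move=> i j ij.
  apply: le_U (cvgD (mul_U LB _ _ (yL i))
    (mul_U (Num.max LB (d i j)) _ _ (xL _ _ ij))) zL _ => n.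
  by have := APCLB_dist (F n) ij.
- move=> i.
  have xiL j : j != i ->
      (Num.max LB (d i j) * x n i j @[n --> U] -->
       Num.max LB (d i j) * x0 i j)%classic.
    by rewrite eq_sym => ij; apply: mul_U; apply: xL.
  apply: le_U (cvgD (mul_U (alpha%:R * LB) _ _ (yL i)) (sum_U _ _ _ xiL))
    (mul_U alpha%:R _ _ zL) _ => n.
  by have := APCLB_sumdist (F n) i.
- by move=> i j ij; apply: le_U (cst_U 0) (xL _ _ ij) _ => n;
    have := APCLB_x_ge0 (F n) ij.
- move=> j; apply/andP; split.
    by apply: le_U (cst_U 0) (yL j) _ => n; case/andP: (APCLB_y_bounds (F n) j).
  by apply: le_U (yL j) (cst_U 1) _ => n; case/andP: (APCLB_y_bounds (F n) j).
- by apply: le_U (cst_U LB) zL _ => n; have := APCLB_z_ge (F n).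
Unshelve. all: by end_near.
Qed.

(** * Assignments along edges of length at most [LB] *)

(** Subtracting [LB] times the assignment equation from the aggregated distance
    constraint leaves a sum of nonnegative terms bounded by [0]. *)
Lemma APCLB_tight_support (R : realType) (N : finType) (d : N -> N -> R)
    (p alpha : nat) (LB : R) y x i j :
  APCLB_feasible d p alpha LB y x LB -> i != j -> LB < d i j -> x i j = 0.
Proof.
move=> F ij dij; have := APCLB_sumdist F i.
have -> : \sum_(j | j != i) Num.max LB (d i j) * x i j =
    LB * (alpha%:R * (1 - y i)) +
    \sum_(j | j != i) (Num.max LB (d i j) - LB) * x i j.
  rewrite -(APCLB_assign F) mulr_sumr -big_split /=.
  by apply: eq_bigr => k _; rewrite mulrBl addrC subrK.
set S := \sum_(j | _) _ => hS; have {hS} S0 : S <= 0 by nra.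
have ge0 k : k != i -> 0 <= (Num.max LB (d i k) - LB) * x i k.
  move=> ki; rewrite mulr_ge0 ?subr_ge0 ?le_max ?lexx //.
  by rewrite (APCLB_x_ge0 F) // eq_sym.
have S00 : S = 0 by apply/le_anti; rewrite S0 sumr_ge0.
have ji : j != i by rewrite eq_sym.
have /eqP := psumr_eq0P ge0 S00 ji.
by rewrite max_r ?ltW // mulf_eq0 subr_eq0 (gt_eqF dij) => /eqP.
Qed.

(** Sharing [s] in proportion to the capacities respects all of them.  If the
    capacities sum to [0] then [s = 0], and the division by [0] below yields
    the zero split. *)
Lemma capacitated_split (R : realType) (I : finType) (E : pred I)
    (c : I -> R) (s : R) :
  (forall j, E j -> 0 <= c j) -> 0 <= s -> s <= \sum_(j | E j) c j ->
  exists2 x : I -> R, forall j, E j -> 0 <= x j <= c j & \sum_(j | E j) x j = s.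
Proof.
move=> c0 s0; set C := \sum_(j | E j) c j => sC.
have C_ge0 : 0 <= C by apply: sumr_ge0.
exists (fun j => s / C * c j) => [j Ej|].
  have r0 : 0 <= s / C by rewrite divr_ge0.
  rewrite mulr_ge0 ?c0 //= ler_piMl ?c0 //.
  have [->|C_neq0] := eqVneq C 0; first by rewrite invr0 mulr0.
  by rewrite ler_pdivrMr ?mul1r // lt_def C_neq0.
rewrite -mulr_sumr -/C.
have [C0|C_neq0] := eqVneq C 0; last by rewrite divfK.
by apply/le_anti; rewrite C0 mulr0 s0 -C0 sC.
Qed.

(** The covering inequalities for client [i] are the cut conditions of a
    transportation problem with capacities [min (y j) (1 - y i)].  The binding
    cut is the set [T] of near points with [1 - y i < y j]: removing
    [N_beta = T] gives the bound when [1 <= #|T| <= alpha], the inequality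
    without removal does so when [T] is empty, and [T] alone covers the demand
    when [alpha < #|T|]. *)
Lemma cover_min_ge (R : realType) (N : finType) (d : N -> N -> R)
    (alpha : nat) (LB : R) (y : N -> R) (i : N) :
  cover_feasible d alpha LB y ->
  alpha%:R * (1 - y i) <=
    \sum_(j | (j != i) && (d i j <= LB)) Num.min (y j) (1 - y i).
Proof.
move=> [call csub yb]; set u := 1 - y i.
have u0 : 0 <= u by rewrite subr_ge0; case/andP: (yb i).
pose T := [set j | [&& j != i, d i j <= LB & u < y j]].
pose b := #|T|.
(* the neighbours in [T] each contribute [u], the others all of [y j] *)
have -> : \sum_(j | (j != i) && (d i j <= LB)) Num.min (y j) u =
    b%:R * u + \sum_(j | (j \notin i |: T) && (d i j <= LB)) y j.
  rewrite (bigID (fun j => u < y j)) /=; congr (_ + _).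
    rewrite mulr_natl -sumr_const; apply: eq_big => [j|j /andP[_ uy]].
      by rewrite inE andbA.
    by rewrite min_r // ltW.
  apply: eq_big => [j|j /andP[_]]; last by rewrite -leNgt => /min_l.
  by rewrite !inE; case: eqP => //= _; case: (d i j <= LB); rewrite /= ?andbT ?andbF.
have [alt|ble] := ltnP alpha b.
  rewrite -[leLHS]addr0 lerD ?sumr_ge0 // => [|j _]; last by case/andP: (yb j).
  by rewrite ler_wpM2r // ler_nat ltnW.
have [b0|b_gt0] := posnP b.
  rewrite b0 mul0r add0r; apply: le_trans (call i) _.
  rewrite (cards0_eq b0).
  by rewrite le_eqVlt; apply/orP; left; apply/eqP/eq_bigl => j; rewrite !inE orbF.
have Ti : T \subset [set~ i].
  by apply/fintype.subsetP => j; rewrite !inE => /andP[].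
have := csub i b T; rewrite b_gt0 ble => /(_ isT Ti erefl).
by rewrite -/u mulrBl lerBlDl.
Qed.

(** Split the assignment of client [i] along [N_beta]: inside, each share is at
    most [1 - y i]; outside, each share is at most [y j]. *)
Lemma APCLB_tight_cover (R : realType) (N : finType) (d : N -> N -> R)
    (p alpha : nat) (LB : R) y x :
  APCLB_feasible d p alpha LB y x LB -> cover_feasible d alpha LB y.
Proof.
move=> F.
have xy i j : j != i -> x i j <= y j by rewrite eq_sym; apply: (APCLB_open F).
have sum_near i :
    alpha%:R * (1 - y i) = \sum_(j | (j != i) && (d i j <= LB)) x i j.
  rewrite -(APCLB_assign F) (bigID (fun j => d i j <= LB)) /=.
  rewrite [X in _ + X]big1 ?addr0 // => j /andP[ji]; rewrite -ltNge.
  by apply: (APCLB_tight_support F); rewrite eq_sym.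
split; last exact: (APCLB_y_bounds F).
  by move=> i; rewrite sum_near; apply: ler_sum => j /andP[/xy].
move=> i beta Nb _ Nbi cardNb; set u := 1 - y i.
rewrite mulrBl sum_near (bigID (mem Nb)) /= lerBlDl; apply: lerD; last first.
  rewrite (eq_bigl (fun j => (j \notin i |: Nb) && (d i j <= LB))) => [|j].
    by apply: ler_sum => j; rewrite !inE negb_or -andbA => /andP[/xy].
  by rewrite !inE negb_or andbAC.
have u0 : 0 <= u by rewrite subr_ge0; case/andP: (APCLB_y_bounds F i).
rewrite -cardNb mulr_natl -sumr_const [leRHS](bigID (fun j => d i j <= LB)) /=.
rewrite -[leLHS]addr0 lerD ?sumr_ge0 //.
rewrite (eq_bigl (fun j => (j \in Nb) && (d i j <= LB))) => [|j]; last first.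
  rewrite andbC andbA; have [jN|//] := boolP (j \in Nb).
  by have := fintype.subsetP Nbi _ jN; rewrite !inE => ->.
apply: ler_sum => j /andP[jN _]; have := fintype.subsetP Nbi _ jN; rewrite !inE => ji.
have := @APCLB_self _ _ _ _ _ _ _ _ _ F i j; rewrite eq_sym => /(_ ji).
by rewrite /u; lra.
Qed.

(** * From a cover to a tight solution of APCLB *)

Lemma cover_LB_ge0 (R : realType) (N : finType) (d : N -> N -> R)
    (p alpha : nat) (LB : R) (y : N -> R) :
  (p < #|N|)%N -> (0 < alpha)%N -> (forall i j, 0 <= d i j) ->
  cover_feasible d alpha LB y -> \sum_j y j <= p%:R -> 0 <= LB.
Proof.
move=> p_lt a_gt0 hd [call _ _] yp; rewrite leNgt; apply/negP => LB0.
suff : #|N|%:R <= p%:R :> R by rewrite ler_nat leqNgt p_lt.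
apply: le_trans yp; rewrite -sumr_const; apply: ler_sum => i _.
have := call i; rewrite big1 => [|j /andP[_ dLB]].
  by rewrite pmulr_rle0 ?ltr0n // subr_le0.
by have := le_lt_trans (le_trans (hd i j) dLB) LB0; rewrite ltxx.
Qed.

(** The covering inequalities are linear, and at the all-ones vector their
    right-hand sides vanish, so they persist on the segment from [y] to the
    all-ones vector; the mass grows along it from at most [p] to [#|N| > p]. *)
Lemma cover_pad (R : realType) (N : finType) (d : N -> N -> R)
    (p alpha : nat) (LB : R) (y : N -> R) :
  (p < #|N|)%N -> cover_feasible d alpha LB y -> \sum_j y j <= p%:R ->
  exists2 y', cover_feasible d alpha LB y' & \sum_j y' j = p%:R.
Proof.
move=> p_lt [call csub yb]; set S := \sum_j y j => Sp.
have pn : p%:R < #|N|%:R :> R by rewrite ltr_nat.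
pose t := (p%:R - S) / (#|N|%:R - S).
have t0 : 0 <= t by rewrite divr_ge0 //; lra.
have t1 : t <= 1 by rewrite ler_pdivrMr; lra.
pose y' j := y j + t * (1 - y j).
have y'E j : 1 - y' j = (1 - t) * (1 - y j) by rewrite /y'; lra.
have y'_ge j : (1 - t) * y j <= y' j by rewrite /y'; lra.
have scale_cover (a : R) (P : pred N) i :
    a * (1 - y i) <= \sum_(j | P j) y j -> a * (1 - y' i) <= \sum_(j | P j) y' j.
  move=> h; rewrite y'E mulrCA.
  apply: (@le_trans _ _ (\sum_(j | P j) (1 - t) * y j)).
    by rewrite -mulr_sumr ler_wpM2l //; lra.
  by apply: ler_sum => j _; apply: y'_ge.
exists y'; last first.
  rewrite big_split /= -mulr_sumr sumrB sumr_const -/S.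
  by rewrite /t divfK ?subrKC // gt_eqF //; lra.
split=> [i|i b Nb hb Nbi cNb|j]; try exact: scale_cover (csub _ _ _ _ _ _).
  exact: scale_cover.
have /andP[y0 y1] := yb j.
have : 0 <= t * (1 - y j) by rewrite mulr_ge0 //; lra.
have : 0 <= (1 - t) * (1 - y j) by rewrite mulr_ge0 //; lra.
by rewrite -y'E /y' => ? ?; apply/andP; split; lra.
Qed.

Lemma cover_tight_APCLB (R : realType) (N : finType) (d : N -> N -> R)
    (p alpha : nat) (LB : R) (y : N -> R) :
  0 <= LB -> cover_feasible d alpha LB y -> \sum_j y j = p%:R ->
  exists x, APCLB_feasible d p alpha LB y x LB.
Proof.
move=> LB0 cov yp; have yb := cover_y_bounds cov.
have u0 i : 0 <= 1 - y i by rewrite subr_ge0; case/andP: (yb i).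
have row i : exists xi : N -> R,
    (forall j, (j != i) && (d i j <= LB) ->
       0 <= xi j <= Num.min (y j) (1 - y i)) /\
    \sum_(j | (j != i) && (d i j <= LB)) xi j = alpha%:R * (1 - y i).
  case: (@capacitated_split _ _ (fun j => (j != i) && (d i j <= LB))
           (fun j => Num.min (y j) (1 - y i)) (alpha%:R * (1 - y i))).
  - by move=> j _; rewrite le_min u0 andbT; case/andP: (yb j).
  - by rewrite mulr_ge0.
  - exact: cover_min_ge.
  - by move=> xi; exists xi.
have [x0 x0P] := choice row.
pose x i j := if d i j <= LB then x0 i j else 0.
have xb i j : i != j -> 0 <= x i j <= Num.min (y j) (1 - y i).
  rewrite eq_sym /x => ij; case: ifP => dij; first by apply: (x0P i).1; rewrite ij.
  by rewrite lexx le_min u0 andbT; case/andP: (yb j).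
have xsum i : \sum_(j | j != i) x i j = alpha%:R * (1 - y i).
  by rewrite -(x0P i).2 -big_mkcondr.
have xmax i j : Num.max LB (d i j) * x i j = LB * x i j.
  by rewrite /x; case: ifP => [/max_l -> //|_]; rewrite !mulr0.
exists x; split => //.
- by move=> i j /xb; rewrite le_min => /and3P[].
- by move=> i j /xb; rewrite le_min => /and3P[_ _]; lra.
- move=> i j /xb; rewrite le_min xmax => /and3P[_ _ xu].
  by rewrite -mulrDr ler_piMr //; lra.
- move=> i; rewrite (eq_bigr _ (fun j _ => xmax i j)) -mulr_sumr xsum.
  by rewrite le_eqVlt; apply/orP; left; apply/eqP; ring.
- by move=> i j /xb /andP[].
Qed.

Theorem theorem13 (R : realType) (N : finType) (d : N -> N -> R)
    (p alpha : nat) (LB : R)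
    (hp : (0 < p < #|N|)%N) (halpha : (0 < alpha <= p)%N)
    (hd : forall i j : N, 0 <= d i j)
    (hLB : LB <= center_opt d p alpha) :
  L_alpha d p alpha LB = LB <->
  exists y : N -> R, cover_feasible d alpha LB y /\ \sum_(j : N) y j <= p%:R.
Proof.
have [_ p_lt] := andP hp; have [a_gt0 _] := andP halpha.
split=> [LE|[y0 [cov0 y0p]]].
  have [y [x]] := APCLB_attained (APCLB_nonempty d LB hp halpha).
  rewrite LE => F; exists y; split; first exact: APCLB_tight_cover F.
  by rewrite (APCLB_card F).
have LB0 := cover_LB_ge0 p_lt a_gt0 hd cov0 y0p.
have [y cov yp] := cover_pad p_lt cov0 y0p.
have [x F] := cover_tight_APCLB LB0 cov yp.
have lbLB : lbound
    [set z : R | exists y x, APCLB_feasible d p alpha LB y x z]%classic LB.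
  by move=> z [? [? /APCLB_z_ge]].
apply/le_anti/andP; split.
  by apply: ge_inf; [exists LB | exists y, x].
by apply: lb_le_inf => //; exists LB, y, x.
Qed.
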